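(* Let $(X,d)$ be a pseudo-distance space (that is, $X$ is a nonempty set and $d:X^2\to[-\infty,\infty]$ is an arbitrary function) and let $f:X\to\mathbb{R}$ be given. If $f$ is uniformly continuous on $(X,d)$, then $\mathrm{SUP}_f$ is uniformly continuous on the pseudo-distance space $(\mathrm{dom}(\mathrm{SUP}_f),D_H)$, and $\mathrm{INF}_f$ is uniformly continuous on the pseudo-distance space $(\mathrm{dom}(\mathrm{INF}_f),D_H)$. If $f$ is $\Lambda$-Lipschitz continuous for some $\Lambda>0$, then $\mathrm{SUP}_f$ is $\Lambda$-Lipschitz continuous on $(\mathrm{dom}(\mathrm{SUP}_f),D_H)$ and $\mathrm{INF}_f$ is $\Lambda$-Lipschitz continuous on $(\mathrm{dom}(\mathrm{INF}_f),D_H)$.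
   Context: A pseudo-distance space $(X,d)$ is a nonempty set $X$ with an arbitrary function $d:X^2\to[-\infty,\infty]$ (no symmetry, nonnegativity, finiteness or triangle inequality is assumed). For $f:X\to\mathbb{R}$ the operators $\mathrm{SUP}_f,\mathrm{INF}_f:2^X\to[-\infty,\infty]$ are $\mathrm{SUP}_f(A):=\sup\{f(a):a\in A\}$ and $\mathrm{INF}_f(A):=\inf\{f(a):a\in A\}$, with $\sup\emptyset:=-\infty$, $\inf\emptyset:=\infty$. For a function $\psi$ with values in $[-\infty,\infty]$, its effective domain $\mathrm{dom}(\psi)$ is the set of points where $\psi$ is a real number; so $\mathrm{dom}(\mathrm{SUP}_f)=\{A\in 2^X:\mathrm{SUP}_f(A)\in\mathbb{R}\}$ and similarly for $\mathrm{INF}_f$ (these consist of nonempty sets). For $x\in X$ and nonempty $A,A'\subseteq X$: $d(x,A):=\inf\{d(x,a):a\in A\}$, $D_{asyH}(A,A'):=\sup\{d(a,A'):a\in A\}$, and $D_H(A,A'):=\max\{D_{asyH}(A,A'),D_{asyH}(A',A)\}\in[-\infty,\infty]$. A real function $g$ on a pseudo-distance space $(Z,\rho)$ is uniformly continuous if for each $\epsilon>0$ there is $\delta>0$ such that for all $(x,y)\in Z^2$ with $\rho(x,y)<\delta$ one has $|g(x)-g(y)|<\epsilon$. It is $\Lambda$-Lipschitz continuous if $|g(x)-g(y)|\le\Lambda\rho(x,y)$ for all $(x,y)\in Z^2$. *)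

(* Defs.v *)
From mathcomp Require Import all_boot all_order all_algebra.
From mathcomp Require Import all_classical all_reals ereal.

Set Implicit Arguments.
Unset Strict Implicit.
Unset Printing Implicit Defensive.

Import Order.TTheory GRing.Theory Num.Theory.

Local Open Scope classical_set_scope.
Local Open Scope ring_scope.
Local Open Scope ereal_scope.

Record pseudoDistSpace (R : realType) := PseudoDistSpace {
  pd_sort :> Type;
  pd_inhabited : inhabited pd_sort;
  pdist : pd_sort -> pd_sort -> \bar R
}.
Arguments pdist {R p}.

Definition pd_unif_continuous (R : realType) (Z : pseudoDistSpace R) (g : Z -> R)
    : Prop :=
  forall eps : R, (0 < eps)%R ->
  exists2 delta : R, (0 < delta)%R &
    forall x y : Z, pdist x y < delta%:E -> (`|g x - g y| < eps)%R.

(* Used with [L > 0], so that [L%:E * +oo = +oo] and [L%:E * -oo = -oo]. *)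
Definition pd_lipschitz (R : realType) (Z : pseudoDistSpace R)
    (L : R) (g : Z -> R) : Prop :=
  forall x y : Z, `|g x - g y|%:E <= L%:E * pdist x y.

Definition SUP (R : realType) (X : Type) (f : X -> R) (A : set X) : \bar R :=
  ereal_sup [set (f a)%:E | a in A].

Definition INF (R : realType) (X : Type) (f : X -> R) (A : set X) : \bar R :=
  ereal_inf [set (f a)%:E | a in A].

Definition effdom (R : realType) (T : Type) (psi : T -> \bar R) : Type :=
  {t : T | psi t \is a fin_num}.

(* [fine] loses no information here, since [psi] is finite on [effdom psi]. *)
Definition on_effdom (R : realType) (T : Type) (psi : T -> \bar R)
    (t : effdom psi) : R :=
  fine (psi (sval t)).

Section Hausdorff.
Variables (R : realType) (X : pseudoDistSpace R).

Definition dist_set (x : X) (A : set X) : \bar R :=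
  ereal_inf [set pdist x a | a in A].

Definition asym_hausdorff (A A' : set X) : \bar R :=
  ereal_sup [set dist_set a A' | a in A].

(* Meant for nonempty sets; see [SUP_fin_nonempty] and [INF_fin_nonempty]. *)
Definition hausdorff (A A' : set X) : \bar R :=
  Order.max (asym_hausdorff A A') (asym_hausdorff A' A).

End Hausdorff.

Section Domains.
Variables (R : realType) (X : pseudoDistSpace R) (f : X -> R).

Lemma SUP_fin_nonempty (A : set X) : SUP f A \is a fin_num -> A !=set0.
Proof.
by apply: contraPP => /set0P/negP/negPn/eqP ->; rewrite /SUP image_set0 ereal_sup0.
Qed.

Lemma INF_fin_nonempty (A : set X) : INF f A \is a fin_num -> A !=set0.
Proof.
by apply: contraPP => /set0P/negP/negPn/eqP ->; rewrite /INF image_set0 ereal_inf0.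
Qed.

Lemma dom_SUP_inhabited : inhabited (effdom (SUP f)).
Proof.
have [x] := pd_inhabited X; apply: inhabits; exists [set x].
by rewrite /SUP image_set1 ereal_sup1.
Qed.

Lemma dom_INF_inhabited : inhabited (effdom (INF f)).
Proof.
have [x] := pd_inhabited X; apply: inhabits; exists [set x].
by rewrite /INF image_set1 ereal_inf1.
Qed.

Definition dom_SUP : pseudoDistSpace R :=
  PseudoDistSpace dom_SUP_inhabited
    (fun A A' : effdom (SUP f) => hausdorff (sval A) (sval A')).

Definition dom_INF : pseudoDistSpace R :=
  PseudoDistSpace dom_INF_inhabited
    (fun A A' : effdom (INF f) => hausdorff (sval A) (sval A')).

End Domains.

(* Main.v *)
Require Import Defs.
From mathcomp Require Import all_boot all_order all_algebra.
From mathcomp Require Import all_classical all_reals ereal.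
From mathcomp Require Import lra.

(** Uniform and Lipschitz continuity are both statements about implications
    of the form: distance below [r] forces oscillation at most [e].  The whole
    theorem comes down to the fact that every such implication valid for [f]
    on points is valid, with the same [r] and [e], for [SUP f] and [INF f] on
    sets ([SUP_inherits], [INF_inherits]).  Indeed, if the Hausdorff distance
    of [A] and [B] is below [r], each point of either set is at distance below
    [r] from some point of the other; so each value of [f] on one set is within
    [e] of a value on the other, and the suprema (resp. infima) of these two
    sets of values then differ by at most [e].

    Uniform continuity passes through such implications directly
    ([inherits_unif_continuous]).  A Lipschitz bound with constant [L] is the
    family of all implications with [e = L r], where [r] runs over all
    reals ([inherits_lipschitz]); for [r < 0] such an implication says that no
    distance is below [r], so these implications also encode that a distance
    carrying a Lipschitz function is nonnegative. *)

Set Implicit Arguments.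
Unset Strict Implicit.
Unset Printing Implicit Defensive.

Import Order.TTheory GRing.Theory Num.Theory.

Local Open Scope classical_set_scope.
Local Open Scope ring_scope.

Section Transfer.
Variables (R : realType) (X Z : pseudoDistSpace R).

Definition oscillation_bound (Y : pseudoDistSpace R) (h : Y -> R) (r e : R) :=
  forall x y : Y, (pdist x y < r%:E)%E -> `|h x - h y| <= e.

Definition inherits_bounds (f : X -> R) (g : Z -> R) :=
  forall r e : R, oscillation_bound f r e -> oscillation_bound g r e.

(** Halving [eps] restores the strict inequality that is weakened to a large
    one when passing to suprema. *)
Lemma inherits_unif_continuous (f : X -> R) (g : Z -> R) :
  inherits_bounds f g -> pd_unif_continuous f -> pd_unif_continuous g.
Proof.
move=> fg fU eps eps0; have eps20 : 0 < eps / 2 by lra.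
have [delta delta0 fdelta] := fU _ eps20; exists delta => // x y xy.
have : `|g x - g y| <= eps / 2.
  by apply: (fg delta) xy => u v uv; apply/ltW/fdelta.
by move=> ?; lra.
Qed.

(** If [`|g x - g y|] exceeded [L] times the distance, a real [r] would lie
    strictly between the distance and [`|g x - g y| / L], and the bound [L r]
    inherited at [r] would be violated. *)
Lemma inherits_lipschitz (f : X -> R) (g : Z -> R) (L : R) :
  0 < L -> inherits_bounds f g -> pd_lipschitz L f -> pd_lipschitz L g.
Proof.
move=> L0 fg fL x y; rewrite -lee_pdivrMl// -EFinM leNgt; apply/negP => xy.
have [r xr rs] : exists2 r : R, (pdist x y < r%:E)%E & r < L^-1 * `|g x - g y|.
  move: xy; case: (pdist x y) => [t|//|] ts.
  - exists ((t + L^-1 * `|g x - g y|) / 2); rewrite ?lte_fin;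
    by move: ts; rewrite lte_fin => ?; lra.
  - by exists (L^-1 * `|g x - g y| - 1); [rewrite ltNyr|lra].
have : `|g x - g y| <= L * r.
  apply: (fg r) xr => u v uv; rewrite -lee_fin EFinM.
  by apply: le_trans (fL u v) _; rewrite lee_pmul2l// ltW.
by rewrite leNgt -ltr_pdivlMl// rs.
Qed.

End Transfer.

Section Extrema.
Variables (R : realType) (X : pseudoDistSpace R) (f : X -> R).
Implicit Types A B : set X.

Lemma asym_hausdorff_lt A B (r : \bar R) a :
  (asym_hausdorff A B < r)%E -> A a -> exists2 b, B b & (pdist a b < r)%E.
Proof.
move=> ABr Aa; have : (dist_set a B < r)%E.
  by apply: le_lt_trans ABr; apply: ereal_sup_ubound; exists a.
by move=> /ereal_inf_lt[_ [b Bb <-] abr]; exists b.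
Qed.

Lemma SUP_le_add A B (r e : R) :
  oscillation_bound f r e -> (asym_hausdorff A B < r%:E)%E ->
  (SUP f A <= SUP f B + e%:E)%E.
Proof.
move=> fre ABr; apply: ge_ereal_sup => _ [a Aa <-].
have [b Bb abr] := asym_hausdorff_lt ABr Aa.
apply: (@le_trans _ _ ((f b)%:E + e%:E)%E).
  rewrite -EFinD lee_fin; have := fre _ _ abr.
  by rewrite ler_norml => /andP[_ ?]; lra.
by apply: leeD2r; apply: ereal_sup_ubound; exists b.
Qed.

(** A point of [A] where [f] is nearly minimal has a companion in [B], so here
    it is the extremum over [B] that gets bounded by the one over [A]; in
    [SUP_le_add] it is the other way round. *)
Lemma INF_sub_le A B (r e : R) :
  oscillation_bound f r e -> (asym_hausdorff A B < r%:E)%E ->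
  (INF f B - e%:E <= INF f A)%E.
Proof.
move=> fre ABr; apply: le_ereal_inf_tmp => _ [a Aa <-].
have [b Bb abr] := asym_hausdorff_lt ABr Aa.
apply: (@le_trans _ _ ((f b)%:E - e%:E)%E).
  by apply: leeD2r; apply: ereal_inf_lbound; exists b.
rewrite -EFinB lee_fin; have := fre _ _ abr.
by rewrite ler_norml => /andP[? _]; lra.
Qed.

Lemma SUP_inherits :
  inherits_bounds (Z := dom_SUP f) f (on_effdom (psi := SUP f)).
Proof.
move=> r e fre [A Afin] [B Bfin]; rewrite /= gt_max => /andP[AB BA].
have := SUP_le_add fre BA; have := SUP_le_add fre AB.
rewrite /on_effdom /= -(fineK Afin) -(fineK Bfin) -!EFinD !lee_fin /=.
by move=> ? ?; rewrite ler_norml; apply/andP; split; lra.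
Qed.

Lemma INF_inherits :
  inherits_bounds (Z := dom_INF f) f (on_effdom (psi := INF f)).
Proof.
move=> r e fre [A Afin] [B Bfin]; rewrite /= gt_max => /andP[AB BA].
have := INF_sub_le fre BA; have := INF_sub_le fre AB.
rewrite /on_effdom /= -(fineK Afin) -(fineK Bfin) -!EFinB !lee_fin /=.
by move=> ? ?; rewrite ler_norml; apply/andP; split; lra.
Qed.

End Extrema.

Theorem theorem3p1 (R : realType) (X : pseudoDistSpace R) (f : X -> R) :
  (pd_unif_continuous f ->
     pd_unif_continuous (Z := dom_SUP f) (on_effdom (psi := SUP f)) /\
     pd_unif_continuous (Z := dom_INF f) (on_effdom (psi := INF f))) /\
  (forall L : R, 0 < L ->
     pd_lipschitz L f ->
     pd_lipschitz (Z := dom_SUP f) L (on_effdom (psi := SUP f)) /\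
     pd_lipschitz (Z := dom_INF f) L (on_effdom (psi := INF f))).
Proof.
split=> [fU|L L0 fL]; split.
- exact: inherits_unif_continuous (@SUP_inherits R X f) fU.
- exact: inherits_unif_continuous (@INF_inherits R X f) fU.
- exact: inherits_lipschitz L0 (@SUP_inherits R X f) fL.
- exact: inherits_lipschitz L0 (@INF_inherits R X f) fL.
Qed.
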